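(* Let $A=[(A_\varepsilon)]\in M_n(\overline{\mathbb{K}}_{as})$ be a hermitian matrix with $\mathrm{supp}(A)=\{A_0\}$, i.e. $A\approx A_0$ with $A_0\in M_n(\mathbb{K})$, and let $u_0,v_0\in\mathbb{C}^n$ be orthogonal vectors of norm one. Put $\nu(A)=[\varepsilon\mapsto|\langle u_0, \exp(iA_\varepsilon)v_0\rangle|]\in\overline{\mathbb{R}}$ and $\nu(A_0)=|\langle u_0,\exp(iA_0)v_0\rangle|\in\mathbb{R}$. Then $\mathrm{supp}(\nu(A))=\{\nu(A_0)\}$. In particular, $\nu(A)\approx\nu(A_0)$.
   Context: Let $\mathbb{K}\in\{\mathbb{R},\mathbb{C}\}$ and $I=\,]0,1]$. A net $x\in\mathbb{K}^I$ is moderate if there is $n\in\mathbb{Z}$ with $|x(\varepsilon)|\le\varepsilon^n$ for all sufficiently small $\varepsilon$, and null if for every $q\in\mathbb{N}$ one has $|x(\varepsilon)|\le\varepsilon^q$ for all sufficiently small $\varepsilon$. The ring of Colombeau generalized numbers is $\overline{\mathbb{K}}=\{\text{moderate nets}\}/\{\text{null nets}\}$; the class of $(x_\varepsilon)$ is written $[(x_\varepsilon)]$. For $x,y\in\overline{\mathbb{K}}$, $x\approx y$ ($x$ is associated to $y$) means $x_\varepsilon-y_\varepsilon\to0$ as $\varepsilon\to0$; for vectors and matrices association is entrywise. $\overline{\mathbb{K}}_{as}$ is the subring of those $x\in\overline{\mathbb{K}}$ with $x\approx x_0$ for some $x_0\in\mathbb{K}$. The support of $p=[(p_\varepsilon)]\in\overline{\mathbb{C}}^m$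 (in particular of a generalized number, or of a matrix viewed as an element of $\overline{\mathbb{C}}^{n^2}$) is $\mathrm{supp}(p)=\{q\in\mathbb{C}^m:\exists\,\varepsilon_k\to0,\ p_{\varepsilon_k}\to q\}$. A matrix over $\overline{\mathbb{K}}$ is hermitian if it equals its conjugate transpose; representatives $(A_\varepsilon)$ are chosen hermitian for every $\varepsilon$. $\langle\cdot,\cdot\rangle$ is the standard hermitian product on $\mathbb{C}^n$. *)

(* Defs.v *)
From HB Require Import structures.
From mathcomp Require Import all_boot all_order all_algebra.
From mathcomp Require Import all_classical all_reals all_analysis.
From mathcomp Require Import complex ring.

Set Implicit Arguments.
Unset Strict Implicit.
Unset Printing Implicit Defensive.

Import Order.TTheory GRing.Theory Num.Theory.
Import numFieldNormedType.Exports.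

Local Open Scope classical_set_scope.
Local Open Scope ring_scope.
Local Open Scope complex_scope.
Local Open Scope quotient_scope.

(* The usual topology on C; matrices then carry the entrywise one. *)
HB.instance Definition _ (R : realType) :=
  NormedModule.copy R[i] (R[i] : numClosedFieldType)^o.

Variant field_kind := real_field | complex_field.

Definition base_field (R : realType) (k : field_kind) : numFieldType :=
  match k with real_field => R | complex_field => R[i] end.

Definition toC (R : realType) (k : field_kind) : base_field R k -> R[i] :=
  match k with real_field => fun x => x%:C | complex_field => fun z => z end.

Definition sconj (R : realType) (k : field_kind) :
    base_field R k -> base_field R k :=
  match k with real_field => fun x => x | complex_field => fun z => z^* end.

(* The modulus, with values in R (the library's `|z| lives in R[i]). *)
Definition cmod (R : realType) (z : R[i]) : R := Normc.normc z.

Section Scalar.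
Variables (R : realType) (k : field_kind).

Fact toC_zmod : zmod_morphism (@toC R k).
Proof. by case: k => //= x y; rewrite raddfB. Qed.

Fact toC_monoid : monoid_morphism (@toC R k).
Proof. by case: k; split => //= x y; rewrite rmorphM. Qed.

HB.instance Definition _ :=
  GRing.isZmodMorphism.Build (base_field R k) R[i] (@toC R k) toC_zmod.
HB.instance Definition _ :=
  GRing.isMonoidMorphism.Build (base_field R k) R[i] (@toC R k) toC_monoid.

Lemma toC_sconj (x : base_field R k) : toC (sconj x) = (toC x)^*.
Proof. by case: k x => //= x; rewrite oppr0. Qed.

Lemma cmod_conj (z : R[i]) : cmod z^* = cmod z.
Proof. by case: z => a b; rewrite /cmod /= sqrrN. Qed.

Lemma normCE (z : R[i]) : `|z| = (cmod z)%:C.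
Proof. by []. Qed.

Lemma cmodM (x y : R[i]) : cmod (x * y) = cmod x * cmod y.
Proof. exact: Normc.normcM. Qed.

Lemma cmodD (x y : R[i]) : cmod (x + y) <= cmod x + cmod y.
Proof. by have := ler_normD x y; rewrite !normCE -rmorphD lecR. Qed.

Lemma cmodN (x : R[i]) : cmod (- x) = cmod x.
Proof. by have := normrN x; rewrite !normCE => -[]. Qed.

Lemma cmod_ge0 (x : R[i]) : 0 <= cmod x.
Proof. by have := normr_ge0 x; rewrite normCE lecR. Qed.

End Scalar.

Section Index.
Variable R : realType.

Definition eps_index := {e : R | 0 < e <= 1}.

Fact eps_index_1 : (0 : R) < (1 : R) <= 1. Proof. by rewrite ltr01 lexx. Qed.

HB.instance Definition _ := SubChoice.on eps_index.
HB.instance Definition _ :=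
  isPointed.Build eps_index (exist _ 1 eps_index_1).

(* The filter of "epsilon sufficiently small" on ]0, 1]. *)
Definition eps_to0 : set_system eps_index :=
  filter_from [set eta : R | 0 < eta]
    (fun eta => [set e : eps_index | val e < eta]).

End Index.
Arguments eps_to0 : clear implicits.

#[export] Instance eps_to0_filter (R : realType) : ProperFilter (eps_to0 R).
Proof.
apply: filter_from_proper.
  apply: filter_from_filter; first by exists 1; rewrite /= ltr01.
  move=> a b /= a0 b0; exists (Num.min a b); first by rewrite /= lt_min a0.
  by move=> e /=; rewrite lt_min => /andP[].
move=> a /= a0.
have h0 : 0 < Num.min (a / 2) 1 <= 1.
  by rewrite lt_min divr_gt0// ltr01 /= ge_min lexx orbT.
exists (exist (fun e : R => is_true (0 < e <= 1)) _ h0) => /=.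
by rewrite gt_min ltr_pdivrMr// ltr_pMr// ltr1n.
Qed.

Section Nets.
Variables (R : realType) (k : field_kind).

Definition net := eps_index R -> base_field R k.
HB.instance Definition _ := GRing.ComNzRing.on net.

Definition is_moderate (x : net) : Prop :=
  exists n : int, \forall e \near eps_to0 R, cmod (toC (x e)) <= val e ^ n.

Definition is_null (x : net) : Prop :=
  forall q : nat, \forall e \near eps_to0 R, cmod (toC (x e)) <= val e ^+ q.

Definition moderate : pred net := fun x => `[< is_moderate x >].

Lemma near_lt (a : R) : 0 < a -> \forall e \near eps_to0 R, val e < a.
Proof. by move=> a0; exists a. Qed.

Lemma is_moderateP (x : net) : is_moderate x <->
  exists N : nat, \forall e \near eps_to0 R, cmod (toC (x e)) <= (val e)^-1 ^+ N.
Proof.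
split=> [[n hn]|[N hN]]; last first.
  by exists (- N%:Z); near=> e; rewrite -exprnN -exprVn; near: e.
exists `|n|%N; near=> e.
have /andP[e0 e1] := valP e.
have hx : cmod (toC (x e)) <= val e ^ n by near: e.
apply: (le_trans hx); case: (n) => m /=.
  rewrite (@le_trans _ _ 1)//; first by rewrite exprn_ile1// ltW.
  by rewrite exprn_ege1// invf_ge1.
by rewrite NegzE -exprnN -exprVn.
Unshelve. all: by end_near. Qed.

Lemma is_moderateB x y : is_moderate x -> is_moderate y -> is_moderate (x - y).
Proof.
move=> /is_moderateP[N hN] /is_moderateP[M hM]; apply/is_moderateP.
exists (N + M).+1; near=> e.
have /andP[e0 e1] := valP e.
have hx : cmod (toC (x e)) <= (val e)^-1 ^+ N by near: e.
have hy : cmod (toC (y e)) <= (val e)^-1 ^+ M by near: e.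
have e2 : val e < 2^-1 by near: e; apply: near_lt; rewrite invr_gt0.
have v1 : 1 <= (val e)^-1 by rewrite invf_ge1.
rewrite -[(x - y) e]/(x e - y e) rmorphB (le_trans (cmodD _ _))// cmodN.
rewrite (@le_trans _ _ (2 * (val e)^-1 ^+ (N + M)))//.
  rewrite mulr_natl mulr2n lerD//.
    by rewrite (le_trans hx)// ler_weXn2l// leq_addr.
  by rewrite (le_trans hy)// ler_weXn2l// leq_addl.
rewrite exprS; apply: ler_wpM2r; first by rewrite exprn_ge0// invr_ge0 ltW.
by rewrite -[leLHS]invrK ltW// ltf_pV2// posrE invr_gt0.
Unshelve. all: by end_near. Qed.

Lemma is_moderateM x y : is_moderate x -> is_moderate y -> is_moderate (x * y).
Proof.
move=> /is_moderateP[N hN] /is_moderateP[M hM]; apply/is_moderateP.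
exists (N + M)%N; near=> e.
rewrite -[(x * y) e]/(x e * y e) rmorphM cmodM exprD.
by apply: ler_pM; rewrite ?cmod_ge0//; near: e.
Unshelve. all: by end_near. Qed.

Lemma is_moderate_bounded (M : R) (x : net) :
  (\forall e \near eps_to0 R, cmod (toC (x e)) <= M) -> is_moderate x.
Proof.
move=> hx; exists (-1); near=> e.
have /andP[e0 e1] := valP e.
have M0 : 0 < `|M| + 1 by rewrite ltr_wpDl.
have heM : val e < (`|M| + 1)^-1 by near: e; apply: near_lt; rewrite invr_gt0.
rewrite (@le_trans _ _ M)//; first by near: e.
rewrite (@le_trans _ _ (`|M| + 1))//.
  by rewrite (le_trans (ler_norm M))// lerDl.
by rewrite -[leLHS]invrK ltW// -[_ ^ (-1)]/(_^-1) ltf_pV2// posrE invr_gt0.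
Unshelve. all: by end_near. Qed.

Lemma is_moderate_cst (c : base_field R k) : is_moderate (fun=> c).
Proof. by apply: (@is_moderate_bounded (cmod (toC c))); near=> e.
Unshelve. all: by end_near. Qed.

Fact moderate_subring_closed : subring_closed moderate.
Proof.
split.
- by apply/asboolP; exact: is_moderate_cst.
- by move=> x y /asboolP hx /asboolP hy; apply/asboolP; exact: is_moderateB.
- by move=> x y /asboolP hx /asboolP hy; apply/asboolP; exact: is_moderateM.
Qed.

HB.instance Definition _ :=
  GRing.isSubringClosed.Build net moderate moderate_subring_closed.

Definition moderate_net := {x : net | moderate x}.
HB.instance Definition _ := SubChoice.on moderate_net.
HB.instance Definition _ :=
  [SubChoice_isSubComNzRing of moderate_net by <:].

Definition null : pred moderate_net := fun x => `[< is_null (val x) >].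

Lemma is_nullD x y : is_null x -> is_null y -> is_null (x + y).
Proof.
move=> hx hy q; near=> e.
have /andP[e0 e1] := valP e.
have e2 : val e < 2^-1 by near: e; apply: near_lt; rewrite invr_gt0.
have hx1 : cmod (toC (x e)) <= val e ^+ q.+1 by near: e; exact: hx.
have hy1 : cmod (toC (y e)) <= val e ^+ q.+1 by near: e; exact: hy.
rewrite -[(x + y) e]/(x e + y e) rmorphD (le_trans (cmodD _ _))//.
rewrite (le_trans (lerD hx1 hy1))// -mulr2n -mulr_natl exprS mulrA.
rewrite ler_piMl// ?exprn_ge0 1?ltW//.
by rewrite -ltr_pdivlMl// mulr1.
Unshelve. all: by end_near. Qed.

Lemma is_nullM x y : is_moderate x -> is_null y -> is_null (x * y).
Proof.
move=> /is_moderateP[N hN] hy q; near=> e.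
have /andP[e0 e1] := valP e.
have hx : cmod (toC (x e)) <= (val e)^-1 ^+ N by near: e.
have hy1 : cmod (toC (y e)) <= val e ^+ (N + q) by near: e; exact: hy.
rewrite -[(x * y) e]/(x e * y e) rmorphM cmodM.
rewrite (le_trans (ler_pM _ _ hx hy1)) ?cmod_ge0//.
by rewrite exprD mulrA -exprMn mulVf ?gt_eqF// expr1n mul1r.
Unshelve. all: by end_near. Qed.

Fact null_idealr_closed : idealr_closed null.
Proof.
split.
- apply/asboolP => q; near=> e.
  have /andP[e0 e1] := valP e.
  by rewrite -[val 0 e]/(0 : base_field R k) rmorph0 /cmod Normc.normc0
    exprn_ge0// ltW.
- apply/asboolP => /(_ 1%N) h.
  have /filter_ex[e [h1]] :
      \forall e \near eps_to0 R, cmod (toC (val (1 : moderate_net) e)) <= val e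
        /\ val e < 1.
    by near=> e; split; near: e; [exact: h|exact: near_lt].
  rewrite ltNge => /negP; apply; apply: le_trans h1.
  by rewrite -[val 1 e]/(1 : base_field R k) rmorph1 /cmod Normc.normc1.
- move=> a u v /asboolP hu /asboolP hv; apply/asboolP.
  rewrite rmorphD rmorphM; apply: is_nullD => //; apply: is_nullM => //.
  by have /asboolP := valP a.
Unshelve. all: by end_near. Qed.

HB.instance Definition _ := isIdealr.Build moderate_net null null_idealr_closed.

End Nets.

(* Colombeau generalized numbers. *)
Definition gnum (R : realType) (k : field_kind) :=
  {ideal_quot (@null R k : idealr (moderate_net R k))}.
HB.instance Definition _ R k := GRing.ComNzRing.on (gnum R k).
HB.instance Definition _ R k := Quotient.on (gnum R k).

Section GNum.
Variables (R : realType) (k : field_kind).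

(* p = [(x_eps)]: the net x is moderate and its class is p. *)
Definition is_rep (x : net R k) (p : gnum R k) : Prop :=
  exists2 m : moderate_net R k, val m = x & \pi_(gnum R k) m = p.

(* A chosen representative; by [assocE] and [suppE], association and support
   can be computed from any other one. *)
Definition rep (p : gnum R k) : net R k := val (repr p).

Lemma rep_is_rep p : is_rep (rep p) p.
Proof. by exists (repr p) => //; rewrite reprK. Qed.

Lemma is_rep_moderate x p : is_rep x p -> is_moderate x.
Proof. by case=> m <- _; have /asboolP := valP m. Qed.

Lemma is_rep_null x y p : is_rep x p -> is_rep y p -> is_null (x - y).
Proof.
case=> m <- <- [m' <-] /esym/eqP.
by rewrite -Quotient.idealrBE => /asboolP; rewrite rmorphB.
Qed.

Lemma is_repB x y p q : is_rep x p -> is_rep y q -> is_rep (x - y) (p - q).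
Proof.
case=> m <- <- [m' <- <-]; exists (m - m'); first by rewrite rmorphB.
by rewrite rmorphB.
Qed.

Lemma is_repM x y p q : is_rep x p -> is_rep y q -> is_rep (x * y) (p * q).
Proof.
case=> m <- <- [m' <- <-]; exists (m * m'); first by rewrite rmorphM.
by rewrite rmorphM.
Qed.

Lemma is_rep1 : is_rep (fun=> 1) 1.
Proof. by exists 1 => //; rewrite rmorph1. Qed.

Fact moderate_cst (c : base_field R k) : moderate (fun=> c : base_field R k).
Proof. by apply/asboolP; exact: is_moderate_cst. Qed.

Definition gcst (c : base_field R k) : gnum R k :=
  \pi_(gnum R k) (exist (fun x => is_true (moderate x)) _ (moderate_cst c)).

Lemma gcst_rep c : is_rep (fun=> c) (gcst c).
Proof. by exists (exist (fun x => is_true (moderate x)) _ (moderate_cst c)). Qed.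

Fact moderate_conj (m : moderate_net R k) :
  moderate (fun e => sconj (val m e)).
Proof.
apply/asboolP; have /asboolP[n hn] := valP m; exists n.
by under eq_near do rewrite toC_sconj cmod_conj.
Qed.

Definition gconj (p : gnum R k) : gnum R k :=
  \pi_(gnum R k)
    (exist (fun x => is_true (moderate x)) _ (moderate_conj (repr p))).

Lemma gconj_rep x p : is_rep x p -> is_rep (fun e => sconj (x e)) (gconj p).
Proof.
case=> m <- <-.
exists (exist (fun x => is_true (moderate x)) _ (moderate_conj m)) => //.
apply/eqP; rewrite -Quotient.idealrBE; apply/asboolP => q.
have := is_rep_null (ex_intro2 _ _ m erefl erefl) (rep_is_rep (\pi_(gnum R k) m)).
move=> /(_ q); apply: filterS => e h; rewrite (le_trans _ h)//.
rewrite -[leRHS]cmod_conj le_eqVlt; apply/orP; left; apply/eqP; congr cmod.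
rewrite -[LHS]/(toC (sconj (val m e) - sconj (rep (\pi_(gnum R k) m) e))).
rewrite -[in RHS]/(toC (val m e - rep (\pi_(gnum R k) m) e)).
by rewrite !rmorphB /= !toC_sconj.
Qed.

Lemma is_null_cvg (x : net R k) : is_null x -> toC (x e) @[e --> eps_to0 R] --> (0 : R[i]).
Proof.
move=> hx; apply/cvgr0Pnorm_lt => -[a b]; rewrite ltcE /= => /andP[/eqP-> a0].
near=> e; have h1 : cmod (toC (x e)) <= val e ^+ 1 by near: e; exact: hx.
rewrite normCE ltcR (le_lt_trans h1)// expr1; near: e; exact: near_lt.
Unshelve. all: by end_near. Qed.

Definition assoc (p q : gnum R k) : Prop :=
  toC (rep p e) - toC (rep q e) @[e --> eps_to0 R] --> (0 : R[i]).

Lemma is_rep_cvg (x : net R k) (p : gnum R k) : is_rep x p ->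
  toC (rep p e) - toC (x e) @[e --> eps_to0 R] --> (0 : R[i]).
Proof.
move=> hx; have := is_null_cvg (is_rep_null (rep_is_rep p) hx).
apply: cvg_trans; apply: near_eq_cvg; apply: nearW => e.
by rewrite -rmorphB.
Qed.

Lemma assocE (x y : net R k) (p q : gnum R k) : is_rep x p -> is_rep y q ->
  assoc p q <-> toC (x e) - toC (y e) @[e --> eps_to0 R] --> (0 : R[i]).
Proof.
move=> /is_rep_cvg cx /is_rep_cvg cy; rewrite /assoc.
have FF : Filter (eps_to0 R) by apply: _.
have cxy := cvgB (FF := FF) cx cy; rewrite subr0 in cxy.
split=> h.
- have := cvgB (FF := FF) h cxy; rewrite subr0; apply: cvg_trans.
  apply: near_eq_cvg; apply: nearW => e; symmetry.
  transitivity (toC (rep p e) - toC (rep q e) -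
    ((toC (rep p e) - toC (x e)) - (toC (rep q e) - toC (y e)))); first by ring.
  by [].
- have := cvgD (FF := FF) h cxy; rewrite addr0; apply: cvg_trans.
  apply: near_eq_cvg; apply: nearW => e; symmetry.
  transitivity (toC (x e) - toC (y e) +
    ((toC (rep p e) - toC (x e)) - (toC (rep q e) - toC (y e)))); first by ring.
  by [].
Qed.

Lemma assoc_cstE (x : net R k) (p : gnum R k) (c : base_field R k) :
  is_rep x p ->
  assoc p (gcst c) <-> toC (x e) @[e --> eps_to0 R] --> toC c.
Proof.
move=> hx; apply: (iff_trans (assocE hx (gcst_rep c))).
exact: (@subr_cvg0 _ R[i] _ (eps_to0 R) _ (fun e => toC (x e)) (toC c)).
Qed.

Definition gassociated : pred (gnum R k) :=
  fun p => `[< exists c : base_field R k, assoc p (gcst c) >].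

Fact gassociated_subring_closed : subring_closed gassociated.
Proof.
split.
- apply/asboolP; exists 1; apply/(assoc_cstE _ is_rep1).
  exact: (@cvg_cst R[i]).
- move=> p q /asboolP[c hc] /asboolP[d hd]; apply/asboolP; exists (c - d).
  have hp := rep_is_rep p; have hq := rep_is_rep q.
  apply/(assoc_cstE _ (is_repB hp hq)); rewrite rmorphB.
  have FF : Filter (eps_to0 R) by apply: _.
  have := @cvgB _ R[i] _ _ FF _ _ _ _ (proj1 (assoc_cstE c hp) hc)
    (proj1 (assoc_cstE d hq) hd).
  apply: cvg_trans; apply: near_eq_cvg; apply: nearW => e.
  exact: (esym (rmorphB (@toC R k) (rep p e) (rep q e))).
- move=> p q /asboolP[c hc] /asboolP[d hd]; apply/asboolP; exists (c * d).
  have hp := rep_is_rep p; have hq := rep_is_rep q.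
  apply/(assoc_cstE _ (is_repM hp hq)); rewrite rmorphM.
  have FF : Filter (eps_to0 R) by apply: _.
  have := @cvgM R[i] _ _ FF _ _ _ _ (proj1 (assoc_cstE c hp) hc)
    (proj1 (assoc_cstE d hq) hd).
  apply: cvg_trans; apply: near_eq_cvg; apply: nearW => e.
  exact: (esym (rmorphM (@toC R k) (rep p e) (rep q e))).
Qed.

HB.instance Definition _ :=
  GRing.isSubringClosed.Build (gnum R k) gassociated gassociated_subring_closed.

End GNum.

(* Limits of a net along the sequences eps_k -> 0. *)
Definition seq_limits (R : realType) (T : topologicalType)
    (x : eps_index R -> T) : set T :=
  [set q | exists e : nat -> eps_index R,
     val (e j) @[j --> \oo] --> (0 : R) /\ x (e j) @[j --> \oo] --> q].

Section Support.
Variables (R : realType) (k : field_kind).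

Definition supp (p : gnum R k) : set R[i] :=
  seq_limits (fun e => toC (rep p e)).

Definition supp_mx m n (A : 'M[gnum R k]_(m, n)) : set 'M[R[i]]_(m, n) :=
  seq_limits (fun e => \matrix_(i, j) toC (rep (A i j) e)).

Lemma eps_seq_cvg (e : nat -> eps_index R) :
  val (e j) @[j --> \oo] --> (0 : R) -> e j @[j --> \oo] --> eps_to0 R.
Proof.
move=> he P [a /= a0 aP]; have /cvgr0Pnorm_lt/(_ _ a0) := he.
apply: filterS => j h; apply: aP => /=.
by apply: le_lt_trans h; exact: ler_norm.
Qed.

Lemma suppE (x : net R k) (p : gnum R k) : is_rep x p ->
  supp p = seq_limits (fun e => toC (x e)).
Proof.
move=> /is_rep_cvg c1; have FF : Filter (\oo : set_system nat) by apply: _.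
apply/seteqP; split=> q [e [e0 ecvg]]; exists e; split; try exact: e0.
- have c2 := cvg_comp _ _ (eps_seq_cvg e0) c1.
  have := @cvgB _ R[i] _ _ FF _ _ _ _ ecvg c2; rewrite subr0.
  apply: cvg_trans; apply: near_eq_cvg; apply: nearW => j; symmetry.
  transitivity (toC (rep p (e j)) -
    (toC (rep p (e j)) - toC (x (e j)))); last by [].
  by ring.
- have c2 := cvg_comp _ _ (eps_seq_cvg e0) c1.
  have := @cvgD _ R[i] _ _ FF _ _ _ _ ecvg c2; rewrite addr0.
  apply: cvg_trans; apply: near_eq_cvg; apply: nearW => j; symmetry.
  transitivity (toC (x (e j)) +
    (toC (rep p (e j)) - toC (x (e j)))); last by [].
  by ring.
Qed.

Definition is_rep_mx m n (x : eps_index R -> 'M[base_field R k]_(m, n))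
    (A : 'M[gnum R k]_(m, n)) : Prop :=
  forall i j, is_rep (fun e => x e i j) (A i j).

Definition shermitian n (A : 'M[base_field R k]_n) : Prop :=
  A = map_mx (@sconj R k) A^T.

Definition ghermitian n (A : 'M[gnum R k]_n) : Prop :=
  A = map_mx (@gconj R k) A^T.

End Support.

Section Exp.
Variables (R : realType) (n : nat).

Definition expm (M : 'M[R[i]]_n) : 'M[R[i]]_n :=
  limn (series (fun j => (j`!%:R)^-1 *: M ^+ j)).

Definition cdot (u v : 'cV[R[i]]_n) : R[i] := dotmx u^T v^T.

Definition cnorm (u : 'cV[R[i]]_n) : R[i] := sqrtC (cdot u u).

Lemma cdotE (u v : 'cV[R[i]]_n) : cdot u v = \sum_i u i 0 * (v i 0)^*.
Proof. by rewrite /cdot dotmxE mxE; apply: eq_bigr => i _; rewrite !mxE. Qed.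

End Exp.

(* |<u, exp(i M) v>| for M over R or C; u and v are always complex. *)
Definition transition (R : realType) (k : field_kind) (n : nat)
    (u v : 'cV[R[i]]_n) (M : 'M[base_field R k]_n) : R :=
  cmod (cdot u (expm ('i *: map_mx (@toC R k) M) *m v)).

(* Main.v *)
(* In the entrywise l^1 norm, comparing the power series term by term shows that
   the matrix exponential is Lipschitz on bounded sets, so the transition
   modulus is a continuous function of the matrix. Since the entries of A are
   associated to constants, which the support identifies as the entries of A_0,
   A_eps tends to A_0 along the whole net; hence nu(A_eps) tends to nu(A_0), and
   a net with a limit is moderate and has that limit as its only support point. *)
Require Import Defs.
From HB Require Import structures.
From mathcomp Require Import all_boot all_order all_algebra.
From mathcomp Require Import all_classical all_reals all_analysis.
From mathcomp Require Import complex ring.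

Set Implicit Arguments.
Unset Strict Implicit.
Unset Printing Implicit Defensive.

Import Order.TTheory GRing.Theory Num.Theory.
Import numFieldNormedType.Exports.

Local Open Scope classical_set_scope.
Local Open Scope ring_scope.

(** * Complex limits and series, measured by the real-valued modulus *)

Section ComplexLimits.
Variable R : realType.
Implicit Types z w : R[i]%C.

Lemma cmodB_sym z w : cmod (z - w) = cmod (w - z).
Proof. by rewrite -cmodN opprB. Qed.

Lemma cmod_real (x : R) : cmod x%:C%C = `|x|.
Proof. by rewrite /cmod /= expr0n addr0 sqrtr_sqr. Qed.

Lemma cmod_natV (j : nat) : cmod (j%:R : R[i]%C)^-1 = (j%:R)^-1.
Proof.
by rewrite /cmod Normc.normcV -(rmorph_nat (real_complex R)) -/(cmod _)
  cmod_real normr_nat.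
Qed.

Lemma ler_dist_cmod z w : `|cmod z - cmod w| <= cmod (z - w).
Proof.
rewrite ler_norml; apply/andP; split.
  by rewrite lerNl opprB lerBlDr cmodB_sym -{1}(subrK z w) cmodD.
by rewrite lerBlDr -{1}(subrK w z) cmodD.
Qed.

Lemma Re_le_cmod z : `|complex.Re z| <= cmod z.
Proof.
by case: z => a b; rewrite /cmod /= -sqrtr_sqr ler_wsqrtr// lerDl sqr_ge0.
Qed.

Lemma Im_le_cmod z : `|complex.Im z| <= cmod z.
Proof.
by case: z => a b; rewrite /cmod /= -sqrtr_sqr ler_wsqrtr// lerDr sqr_ge0.
Qed.

(** The norm on [R[i]] takes values in [R[i]], so radii of balls are complex; a positive one has
    zero imaginary part, which reduces everything to real radii. *)
Lemma cvg_cmodP (T : Type) (F : set_system T) (FF : Filter F)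
    (f : T -> R[i]%C) z :
  f @ F --> z <-> cmod (f x - z) @[x --> F] --> (0 : R).
Proof.
split=> [/cvgrPdistC_lt h|/cvgr0Pnorm_lt h].
  apply/cvgr0Pnorm_lt => e e0; have e0' : 0 < e%:C%C by rewrite ltcR.
  by have := h _ e0'; apply: filterS => x; rewrite normCE ltcR ger0_norm ?cmod_ge0.
apply/cvgrPdistC_lt => -[a b]; rewrite ltcE /= => /andP[/eqP-> a0].
by have := h _ a0; apply: filterS => x; rewrite ger0_norm ?cmod_ge0// -ltcR normCE.
Qed.

Lemma cvg_cmod (T : Type) (F : set_system T) (FF : Filter F)
    (f : T -> R[i]%C) z :
  f @ F --> z -> cmod (f x) @[x --> F] --> cmod z.
Proof.
move=> /cvg_cmodP fz; apply/cvgrPdistC_lt => e e0.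
move/cvgr0Pnorm_lt : fz => /(_ _ e0); apply: filterS => x.
by apply: le_lt_trans; rewrite (le_trans (ler_dist_cmod _ _))// ler_norm.
Qed.

Lemma cvg_real_complex (T : Type) (F : set_system T) (FF : Filter F)
    (f : T -> R) (l : R) :
  f @ F --> l -> (f x)%:C%C @[x --> F] --> (l%:C%C : R[i]%C).
Proof.
move=> /cvgrPdistC_lt fl; apply/cvg_cmodP/cvgr0Pnorm_lt => e /fl.
by apply: filterS => x; rewrite -rmorphB cmod_real normr_id.
Qed.

(** Real and imaginary parts are dominated by the modulus, hence by [b]; both real series converge
    absolutely and are recombined as [Re + i Im]. *)
Lemma series_complex_cvg (z : nat -> R[i]%C) (b : nat -> R) :
  (forall j, cmod (z j) <= b j) -> cvgn (series b) -> cvgn (series z).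
Proof.
move=> zb cb.
have b0 j : 0 <= b j by rewrite (le_trans (cmod_ge0 _) (zb j)).
have cre : cvgn (series (fun j => complex.Re (z j))).
  apply: normed_cvg; apply: (series_le_cvg _ b0 _ cb) => //= j.
  by rewrite (le_trans (Re_le_cmod _)).
have cim : cvgn (series (fun j => complex.Im (z j))).
  apply: normed_cvg; apply: (series_le_cvg _ b0 _ cb) => //= j.
  by rewrite (le_trans (Im_le_cmod _)).
set x := limn (series (fun j => complex.Re (z j))) in cre *.
set y := limn (series (fun j => complex.Im (z j))) in cim *.
have -> : series z = fun n => (series (fun j => complex.Re (z j)) n)%:C%C
    + 'i%C * (series (fun j => complex.Im (z j)) n)%:C%C.
  apply/funext => n; rewrite /series /= !rmorph_sum mulr_sumr -big_split /=.
  by apply: eq_bigr => j _; rewrite -complexE.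
apply/cvg_ex; exists (x%:C%C + 'i%C * y%:C%C).
apply: (@cvgD _ R[i]%C); first exact: cvg_real_complex.
by apply: (@cvgMr R[i]%C); exact: cvg_real_complex.
Qed.

End ComplexLimits.

(** * Entrywise convergence of matrices *)

Lemma cvg_mxP (U : topologicalType) (T : Type) (F : set_system T)
    (FF : Filter F) m n (f : T -> 'M[U]_(m, n)) (M : 'M[U]_(m, n)) :
  f @ F --> M <-> forall i j, f x i j @[x --> F] --> M i j.
Proof.
split=> [fM i j P MP|fM P [Q MQ QP]].
  apply: (fM [set N : 'M[U]_(m, n) | P (N i j)]).
  (* Only the entry at [(i, j)] is constrained. *)
  exists (fun i' j' => if (i' == i) && (j' == j) then P else setT).
    move=> i' j'; case: ifP => [/andP[/eqP-> /eqP->]//|_]; exact: filterT.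
  by move=> N /(_ i j); rewrite !eqxx.
apply: (filterS (P := fun x => forall i j, Q i j (f x i j))).
  by move=> x Qx; exact: QP.
apply: filter_forall => i; apply: filter_forall => j.
exact: fM (MQ i j).
Qed.

(** * The entrywise l^1 norm *)

Section MatrixNorm.
Variable R : realType.

(** This norm is submultiplicative, but the identity matrix has norm equal to its size; hence the
    factor [mxl1 1%:M] in the bounds on powers. *)
Definition mxl1 m n (M : 'M[R[i]%C]_(m, n)) : R := \sum_i \sum_j cmod (M i j).

Lemma mxB m n (M N : 'M[R[i]%C]_(m, n)) i j : (M - N) i j = M i j - N i j.
Proof. by rewrite !mxE. Qed.

Lemma mxl1_ge0 m n (M : 'M[R[i]%C]_(m, n)) : 0 <= mxl1 M.
Proof. by do 2 (apply: sumr_ge0 => ? _); exact: cmod_ge0. Qed.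

Lemma cmod_le_mxl1 m n (M : 'M[R[i]%C]_(m, n)) i j : cmod (M i j) <= mxl1 M.
Proof.
rewrite /mxl1 (bigD1 i)//= (bigD1 j)//= -addrA lerDl addr_ge0//.
  by apply: sumr_ge0 => ? _; exact: cmod_ge0.
by do 2 (apply: sumr_ge0 => ? _); exact: cmod_ge0.
Qed.

Lemma cmod_sum (I : Type) (r : seq I) (P : pred I) (f : I -> R[i]%C) :
  cmod (\sum_(i <- r | P i) f i) <= \sum_(i <- r | P i) cmod (f i).
Proof.
elim/big_ind2 : _ => //; first by rewrite /cmod Normc.normc0.
by move=> a b c d ab cd; rewrite (le_trans (cmodD _ _))// lerD.
Qed.

Lemma mxl1D m n (M N : 'M[R[i]%C]_(m, n)) : mxl1 (M + N) <= mxl1 M + mxl1 N.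
Proof.
rewrite -big_split ler_sum//= => i _; rewrite -big_split ler_sum//= => j _.
by rewrite mxE cmodD.
Qed.

Lemma mxl1_sum m n (I : Type) (r : seq I) (P : pred I) (f : I -> 'M[R[i]%C]_(m, n)) :
  mxl1 (\sum_(i <- r | P i) f i) <= \sum_(i <- r | P i) mxl1 (f i).
Proof.
elim/big_ind2 : _ => //.
  by do 2 (rewrite /mxl1 big1// => ? _); rewrite mxE /cmod Normc.normc0.
by move=> a b c d ab cd; rewrite (le_trans (mxl1D _ _))// lerD.
Qed.

Lemma mxl1Z m n (a : R[i]%C) (M : 'M[R[i]%C]_(m, n)) : mxl1 (a *: M) = cmod a * mxl1 M.
Proof.
rewrite mulr_sumr; apply: eq_bigr => i _; rewrite mulr_sumr.
by apply: eq_bigr => j _; rewrite mxE cmodM.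
Qed.

Lemma mxl1M m n p (M : 'M[R[i]%C]_(m, n)) (N : 'M[R[i]%C]_(n, p)) :
  mxl1 (M *m N) <= mxl1 M * mxl1 N.
Proof.
rewrite mulr_suml; apply: ler_sum => i _.
apply: (@le_trans _ _ (\sum_k \sum_j cmod (M i j) * cmod (N j k))).
  apply: ler_sum => k _; rewrite mxE (le_trans (cmod_sum _ _ _))//.
  by apply: ler_sum => j _; rewrite cmodM.
rewrite exchange_big mulr_suml; apply: ler_sum => j _ /=.
rewrite -mulr_sumr ler_wpM2l ?cmod_ge0// /mxl1 (bigD1 j)//= lerDl.
by do 2 (apply: sumr_ge0 => ? _); exact: cmod_ge0.
Qed.

Lemma cvg_mxl1 (T : Type) (F : set_system T) (FF : Filter F) m n
    (f : T -> 'M[R[i]%C]_(m, n)) (M : 'M[R[i]%C]_(m, n)) :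
  (forall i j, f x i j @[x --> F] --> M i j) ->
  mxl1 (f x) @[x --> F] --> mxl1 M.
Proof.
move=> fM; apply: cvg_big => [|i _]; first exact: add_continuous.
apply: cvg_big => [|j _]; first exact: add_continuous.
exact: cvg_cmod.
Qed.

(** * Powers, the exponential and the transition modulus *)

Section Square.
Variable n : nat.
Implicit Types M N : 'M[R[i]%C]_n.

Lemma mxl1X M (K : R) j :
  mxl1 M <= K -> mxl1 (M ^+ j) <= mxl1 (1%:M : 'M[R[i]%C]_n) * K ^+ j.
Proof.
move=> MK; elim: j => [|j IH]; first by rewrite expr0 mulr1.
rewrite exprSr (le_trans (mxl1M _ _))// exprSr mulrA.
by apply: ler_pM => //; exact: mxl1_ge0.
Qed.

(* The factor 2 ^+ j is a crude bound for the factor j of the derivative. *)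
Lemma mxl1XB M N (K : R) j : 1 <= K -> mxl1 M <= K -> mxl1 N <= K ->
  mxl1 (M ^+ j - N ^+ j)
    <= mxl1 (1%:M : 'M[R[i]%C]_n) * (2 * K) ^+ j * mxl1 (M - N).
Proof.
move=> K1 MK NK; set c := mxl1 1%:M; set d := mxl1 (M - N).
have c0 : 0 <= c by exact: mxl1_ge0.
have d0 : 0 <= d by exact: mxl1_ge0.
have K0 : 0 <= K by rewrite (le_trans _ K1).
elim: j => [|j IH].
  rewrite !expr0 subrr -(scale0r (0 : 'M[R[i]%C]_n)) mxl1Z /cmod Normc.normc0 mul0r.
  by rewrite !mulr_ge0.
have -> : M ^+ j.+1 - N ^+ j.+1 = M ^+ j * (M - N) + (M ^+ j - N ^+ j) * N.
  by rewrite !exprSr mulrBr mulrBl addrA subrK.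
rewrite (le_trans (mxl1D _ _))//.
(* Each summand is at most half of the target, and the doubling from [j] to [j.+1] absorbs the sum.
   For the first summand this uses [1 <= 2 ^+ j] and [1 <= K]; the second is the induction
   hypothesis times the norm of [N]. *)
apply: (@le_trans _ _ (c * (2 * K) ^+ j * K * d + c * (2 * K) ^+ j * K * d)).
  apply: lerD.
    rewrite (le_trans (mxl1M _ _))// ler_wpM2r//.
    rewrite (le_trans (mxl1X _ MK))// -mulrA ler_wpM2l// exprMn.
    rewrite -[leLHS]mul1r -mulrA ler_pM//; first by rewrite exprn_ge0.
      by rewrite exprn_ege1// ler1n.
    by rewrite ler_peMr// exprn_ge0.
  rewrite (le_trans (mxl1M _ _))// mulrAC ler_pM//; exact: mxl1_ge0.
by rewrite exprSr le_eqVlt; apply/orP; left; apply/eqP; ring.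
Qed.

(** [expm] is a [limn], so it is meaningful only once the series is known to converge. Each entry is
    dominated by a multiple of the real exponential series at [mxl1 M]. *)
Lemma expm_cvg M :
  series (fun j => (j`!%:R)^-1 *: M ^+ j) x @[x --> \oo] --> expm M.
Proof.
have cs i j : cvgn (series (fun l => ((l`!%:R)^-1 *: M ^+ l) i j)).
  apply: (@series_complex_cvg _ _
    (mxl1 (1%:M : 'M[R[i]%C]_n) *: exp_coeff (mxl1 M))); last first.
    by apply: is_cvg_seriesZ; exact: is_cvg_series_exp_coeff.
  move=> l; rewrite mxE cmodM cmod_natV mulrC.
  rewrite -[leRHS]/(mxl1 (1%:M : 'M[R[i]%C]_n) * (mxl1 M ^+ l / l`!%:R)) mulrA.
  rewrite ler_wpM2r ?invr_ge0//.
  by rewrite (le_trans (cmod_le_mxl1 _ _ _))// mxl1X.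
apply/cvg_ex.
exists (\matrix_(i, j) limn (series (fun l => ((l`!%:R)^-1 *: M ^+ l) i j))).
apply/cvg_mxP => i j; rewrite mxE.
by under eq_fun do rewrite /series /= summxE; exact: cs.
Qed.

(** The terms of the two partial sums are compared by [mxl1XB]; the powers of [2 * K] sum to at most
    [expR (2 * K)], and the bound passes to the limit. *)
Lemma mxl1_expmB M N (K : R) : 1 <= K -> mxl1 M <= K -> mxl1 N <= K ->
  mxl1 (expm M - expm N)
    <= mxl1 (1%:M : 'M[R[i]%C]_n) * expR (2 * K) * mxl1 (M - N).
Proof.
move=> K1 MK NK.
set s := fun P : 'M[R[i]%C]_n => series (fun j => (j`!%:R)^-1 *: P ^+ j).
have cMN : mxl1 (s M x - s N x) @[x --> \oo] --> mxl1 (expm M - expm N).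
  apply: cvg_mxl1 => i j.
  have /cvg_mxP/(_ i j) cM := @expm_cvg M.
  have /cvg_mxP/(_ i j) cN := @expm_cvg N.
  rewrite mxB; under eq_fun do rewrite mxB.
  exact: (@cvgB _ R[i]%C _ _ _ _ _ _ _ cM cN).
apply: (cvgr_to_le cMN); apply: nearW => p.
apply: (@le_trans _ _
    (mxl1 (1%:M : 'M[R[i]%C]_n) * series (exp_coeff (2 * K)) p * mxl1 (M - N))).
  rewrite /s /series /= -sumrB (le_trans (mxl1_sum _ _ _))//.
  rewrite [leRHS]mulrAC mulr_sumr; apply: ler_sum => j _.
  rewrite -scalerBr mxl1Z cmod_natV mulrC /exp_coeff mulrA [X in _ <= X / _]mulrAC.
  by rewrite ler_wpM2r ?invr_ge0// mxl1XB.
rewrite ler_wpM2r ?mxl1_ge0// ler_wpM2l ?mxl1_ge0//.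
apply: nondecreasing_cvgn_le; last exact: is_cvg_series_exp_coeff.
apply: nondecreasing_series => j _ _; rewrite exp_coeff_ge0//.
by rewrite mulr_ge0// (le_trans _ K1).
Qed.

Lemma cmod_cdot (u v : 'cV[R[i]%C]_n) : cmod (cdot u v) <= mxl1 u * mxl1 v.
Proof.
rewrite cdotE (le_trans (cmod_sum _ _ _))// mulr_suml ler_sum// => i _.
rewrite cmodM cmod_conj big_ord1 ler_wpM2l ?cmod_ge0//.
exact: cmod_le_mxl1.
Qed.

Lemma cdotBr (u v w : 'cV[R[i]%C]_n) : cdot u (v - w) = cdot u v - cdot u w.
Proof.
rewrite !cdotE -sumrB; apply: eq_bigr => i _.
by rewrite -mulrBr -rmorphB mxB.
Qed.

(** The reverse triangle inequality removes the moduli, linearity isolates the difference of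
    exponentials, and multiplication by ['i] preserves the norm. *)
Lemma transition_lip (k : field_kind) (u v : 'cV[R[i]%C]_n)
    (P Q : 'M[base_field R k]_n) (K : R) :
  let toM : 'M[base_field R k]_n -> 'M[R[i]%C]_n := map_mx (@toC R k) in
  1 <= K -> mxl1 (toM P) <= K -> mxl1 (toM Q) <= K ->
  `|transition u v P - transition u v Q| <=
    mxl1 u * mxl1 (1%:M : 'M[R[i]%C]_n) * expR (2 * K) * mxl1 v
      * mxl1 (toM P - toM Q).
Proof.
move=> toM K1 PK QK; rewrite /transition (le_trans (ler_dist_cmod _ _))//.
have ci : cmod ('i : R[i]%C) = 1.
  by have := normCi R[i]%C; rewrite normCE => -[].
have mi (M : 'M[R[i]%C]_n) : mxl1 ('i *: M) = mxl1 M by rewrite mxl1Z ci mul1r.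
have := @mxl1_expmB ('i *: toM P) ('i *: toM Q) K K1.
rewrite !mi => /(_ PK QK); rewrite -scalerBr mi -/(toM P) -/(toM Q).
move: (expm ('i *: toM P)) (expm ('i *: toM Q)) => E F EF.
rewrite -cdotBr -mulmxBl (le_trans (cmod_cdot _ _))// -!mulrA.
rewrite ler_wpM2l ?mxl1_ge0// (le_trans (mxl1M _ _))//.
rewrite [X in _ * (_ * X)]mulrC !mulrA.
by rewrite ler_wpM2r ?mxl1_ge0.
Qed.

Lemma cvg_transition (T : Type) (F : set_system T) (FF : Filter F)
    (k : field_kind) (u v : 'cV[R[i]%C]_n)
    (P : T -> 'M[base_field R k]_n) (Q : 'M[base_field R k]_n) :
  (forall i j, toC (P x i j) @[x --> F] --> toC (Q i j)) ->
  transition u v (P x) @[x --> F] --> transition u v Q.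
Proof.
move=> PQ; pose toM (M : 'M[base_field R k]_n) := map_mx (@toC R k) M.
have cP : mxl1 (toM (P x)) @[x --> F] --> mxl1 (toM Q).
  by apply: cvg_mxl1 => i j; rewrite mxE; under eq_fun do rewrite mxE; exact: PQ.
have cd : mxl1 (toM (P x) - toM Q) @[x --> F] --> (0 : R).
  have -> : (0 : R) = mxl1 (0 : 'M[R[i]%C]_n).
    by rewrite /mxl1 big1// => i _; rewrite big1// => j _;
       rewrite mxE /cmod Normc.normc0.
  apply: cvg_mxl1 => i j; rewrite mxE; under eq_fun do rewrite !mxE.
  rewrite -(subrr (toC (Q i j))).
  exact: (@cvgB _ R[i]%C _ _ _ _ _ _ _ (PQ i j) (cvg_cst _)).
(* The added 1 ensures [1 <= K] and leaves room for [P x], whose norm is eventually within 1 of that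
   of [Q]; one Lipschitz constant then serves for all such [x]. *)
set K := mxl1 (toM Q) + 1.
have K1 : 1 <= K by rewrite lerDr mxl1_ge0.
set C := mxl1 u * mxl1 (1%:M : 'M[R[i]%C]_n) * expR (2 * K) * mxl1 v.
have cC : C * mxl1 (toM (P x) - toM Q) @[x --> F] --> (0 : R).
  by rewrite -(mulr0 C); apply: cvgM => //; exact: cvg_cst.
apply/cvgrPdistC_lt => e e0.
move/cvgr0Pnorm_lt : cC => /(_ _ e0) h1.
move/cvgrPdistC_lt : cP => /(_ _ ltr01) h2.
apply: filterS2 h1 h2 => x h1 h2; apply: le_lt_trans h1.
apply: le_trans (ler_norm _); apply: transition_lip => //.
  by rewrite -lerBlDl (le_trans (ler_norm _))// ltW.
by rewrite lerDl.
Qed.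

End Square.
End MatrixNorm.

(** * Limits of nets and their supports *)

Lemma seq_limits_cvg (R : realType) (x : eps_index R -> R[i]%C) (l : R[i]%C) :
  x e @[e --> eps_to0 R] --> l -> seq_limits x = [set l].
Proof.
move=> xl; apply/seteqP; split=> [q [e [e0 eq]]|_ ->] /=.
  have := cvg_comp _ _ (eps_seq_cvg e0) xl.
  exact: (@cvg_unique _ (@norm_hausdorff _ R[i]%C) _ _ _ _ eq).
(* The sequence [1 / (j + 1)] stays in the index set and tends to 0, so the limit is actually
   attained as a support point. *)
have h01 (j : nat) : 0 < (harmonic j : R) <= 1.
  by rewrite harmonic_gt0 /= invf_le1// ler1n.
pose e (j : nat) : eps_index R := exist (fun e : R => is_true (0 < e <= 1)) _ (h01 j).
have e0 : val (e j) @[j --> \oo] --> (0 : R) by exact: cvg_harmonic.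
by exists e; split => //; exact: cvg_comp (eps_seq_cvg e0) xl.
Qed.

(** Membership in [gassociated] gives each entry a limit along the whole net without naming it; a
    support point is a limit along some sequence, so uniqueness of limits identifies the two. *)
Lemma supp_mx_cvg (R : realType) (k : field_kind) m n
    (A : 'M[gnum R k]_(m, n)) (Aeps : eps_index R -> 'M[base_field R k]_(m, n))
    (M : 'M[R[i]%C]_(m, n)) :
  A \is a mxOver (@gassociated R k) -> is_rep_mx Aeps A -> supp_mx A M ->
  forall i j, toC (Aeps e i j) @[e --> eps_to0 R] --> M i j.
Proof.
move=> /mxOverP A_as Arep [e [e0 eM]] i j.
have /asboolP[c Ac] := A_as i j.
have repc := proj1 (assoc_cstE c (rep_is_rep (A i j))) Ac.
have Aepsc := proj1 (assoc_cstE c (Arep i j)) Ac.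
have ec : toC (rep (A i j) (e x)) @[x --> \oo] --> toC c.
  exact: cvg_comp (eps_seq_cvg e0) repc.
move/cvg_mxP : eM => /(_ i j); under eq_fun do rewrite mxE; move=> eMij.
have cM : toC c = M i j.
  exact: (@cvg_unique _ (@norm_hausdorff _ R[i]%C) _ _ _ _ ec eMij).
exact: (eq_ind _ (fun l => _ --> l) Aepsc _ cM).
Qed.

Theorem proposition5p9 (R : realType) (k : field_kind) (n : nat)
    (A : 'M[gnum R k]_n) (Aeps : eps_index R -> 'M[base_field R k]_n)
    (A0 : 'M[base_field R k]_n) (u0 v0 : 'cV[R[i]]_n)
    (A_as : A \is a mxOver (@gassociated R k))
    (A_herm : ghermitian A)
    (Aeps_rep : is_rep_mx Aeps A)
    (Aeps_herm : forall e : eps_index R, shermitian (Aeps e))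
    (A_supp : supp_mx A = [set map_mx (@toC R k) A0])
    (u0_norm : cnorm u0 = 1) (v0_norm : cnorm v0 = 1)
    (u0_v0_orth : cdot u0 v0 = 0) :
  exists nuA : gnum R real_field,
    [/\ is_rep (fun e => transition u0 v0 (Aeps e) : base_field R real_field) nuA,
        supp nuA = [set (transition u0 v0 A0)%:C%C]
      & assoc nuA (gcst (transition u0 v0 A0 : base_field R real_field))].
Proof.
have AA0 : supp_mx A (map_mx (@toC R k) A0) by rewrite A_supp.
have cA i j : toC (Aeps e i j) @[e --> eps_to0 R] --> toC (A0 i j).
  by have := @supp_mx_cvg _ _ _ _ _ _ _ A_as Aeps_rep AA0 i j; rewrite mxE.
have ct : transition u0 v0 (Aeps e) @[e --> eps_to0 R] --> transition u0 v0 A0.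
  exact: cvg_transition.
pose x : net R real_field := fun e => transition u0 v0 (Aeps e).
have x_mod : moderate x.
  (* A convergent net is eventually within 1 of its limit, hence bounded, hence moderate. *)
  apply/asboolP; apply: (@is_moderate_bounded _ _ (transition u0 v0 A0 + 1)).
  move/cvgrPdistC_lt : ct => /(_ _ ltr01); apply: filterS => e h.
  rewrite [cmod _]cmod_real ger0_norm ?cmod_ge0// -lerBlDl.
  by rewrite (le_trans (ler_norm _))// ltW.
pose m : moderate_net R real_field := exist (fun y => is_true (moderate y)) _ x_mod.
have [p xp] : exists p, is_rep x p by exists (\pi_(gnum R real_field) m)%qT, m.
have cx : toC (x e) @[e --> eps_to0 R] --> (transition u0 v0 A0)%:C%C.
  exact: cvg_real_complex.
exists p; split; first exact: xp.
  by rewrite (suppE xp); exact: (@seq_limits_cvg _ _ _ cx).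
exact: (proj2 (assoc_cstE _ xp) cx).
Qed.
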